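(* Let $U$ be an $N\times N$ unitary matrix, let $\mathcal S$ be a spanning set for $U$ and $\mathcal I$ a pattern set associated with $U$ and $\mathcal S$. Let $\mathcal F\subset\mathbb R^{2N^2}$ be a differentiable manifold containing $\mathrm{vec}_{\mathbb R}(U)$ (stemming from it), every element of which is of the form $\mathrm{vec}_{\mathbb R}(V)$ where $V$ is a unitary matrix with the same pattern of the moduli as $U$ (i.e. $|V_{i,j}|=|U_{i,j}|$ for all $i,j$) that is dephased with respect to $U$ according to the pattern set $\mathcal I$ associated with $\mathcal S$. Then $$\dim\mathcal F=\dim\big(\mathbf T_U\mathcal F\big)\ \le\ \mathbf b(U),\qquad \mathbf b(U)=\mathbf d(U)+(2N-1)-\sharp_0U-\sharp\mathcal S,$$ where $\mathbf T_U\mathcal F$ is the space tangent to $\mathcal F$ at $\mathrm{vec}_{\mathbb R}(U)$, $\sharp_0U$ is the number of zero entries of $U$, and $\sharp\mathcal S$ is the number of elements of $\mathcal S$.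
   Context: For a complex $N\times N$ matrix $A$, $\mathrm{vec}_{\mathbb R}(A)\in\mathbb R^{2N^2}$ is the vector of real parts of the entries (row by row) followed by the vector of imaginary parts; for a real matrix $A$, $\mathrm{vec}(A)\in\mathbb R^{N^2}$ lists its entries row by row. $e_k$ is the $k$-th standard basis column vector, $\mathbf e=[1,\dots,1]^T$, $\mathrm{diag}(v)$ the diagonal matrix with diagonal $v$, $\circ$ the entrywise (Hadamard) product, $\mathbf i$ the imaginary unit. Defect: let $f$ send a complex $N\times N$ matrix $U$ to the real matrix $(|U_{i,j}|^2)_{i,j}$, with (real) differential $Df_U(V)=\big(2\,\mathrm{Re}(\overline{U_{i,j}}V_{i,j})\big)_{i,j}$; for unitary $U$ let $T_U=\{EU:E^*=-E\}$ be the tangent space at $U$ to the manifold of unitary matrices. Then $\mathbf d(U)=(N-1)^2-\dim_{\mathbb R}Df_U(T_U)$. Spanning set: a spanning set for $U$ is a set of linearly independent vectors $\mathcal S=\{\mathrm{vec}_{\mathbb R}(\mathbf i\,\mathrm{diag}(e_{i_k})U):k=1..p\}\cup\{\mathrm{vec}_{\mathbb R}(U\,\mathbf i\,\mathrm{diag}(e_{j_l})):l=1..r\}$ with $p+r\le 2N-1$ elements which is a basis of the real linear span of all the vectors $\mathrm{vec}_{\mathbb R}(\mathbf i\,\mathrm{diag}(e_k)U)$ and $\mathrm{vec}_{\mathbb R}(U\,\mathbf i\,\mathrm{diag}(e_l))$, $k,l\in\{1..N\}$. Pattern set: a pattern set associated with $U$ and $\mathcal S$ is a $(p+r)$-element set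 $\mathcal I\subset\{1..N\}\times\{1..N\}$ such that $U_{i,j}\ne0$ for all $(i,j)\in\mathcal I$ and, with $F=\sum_{(i,j)\in\mathcal I}e_ie_j^T$, the $p+r$ vectors $\mathrm{vec}((e_{i_k}\mathbf e^T)\circ F)$, $k=1..p$, $\mathrm{vec}((\mathbf e\,e_{j_l}^T)\circ F)$, $l=1..r$, are linearly independent. Dephased: a unitary $V$ with $|V_{i,j}|=|U_{i,j}|$ for all $i,j$ is dephased with respect to $U$, according to the pattern set $\mathcal I$ associated with $\mathcal S$, if $V_{i,j}=U_{i,j}$ for all $(i,j)\in\mathcal I$. *)

(* Defs.v *)
From HB Require Import structures.
From mathcomp Require Import all_boot all_order all_algebra.
From mathcomp Require Import spectral complex.
From mathcomp Require Import all_classical all_reals all_analysis.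

Set Implicit Arguments.
Unset Strict Implicit.
Unset Printing Implicit Defensive.

Import Order.TTheory GRing.Theory Num.Theory.
Import numFieldNormedType.Exports.

Local Open Scope classical_set_scope.
Local Open Scope ring_scope.
Local Open Scope complex_scope.
Local Open Scope sesquilinear_scope.

(* [has_dim A k]: the set [A] is a linear subspace of dimension [k]. *)
Definition has_dim (R : fieldType) (V : vectType R) (A : set V) (k : nat) :=
  exists W : {vspace V}, A = [set` W] /\ \dim W = k.

(* Dimension of [A]; only meaningful when [A] is a linear subspace (see
   [has_dim_rdim] and [has_dim_Df_tangent_unitary] below). *)
Definition rdim (R : fieldType) (V : vectType R) (A : set V) : nat :=
  xget 0%N [set k | has_dim A k].

Lemma has_dim_uniq (R : fieldType) (V : vectType R) (A : set V) k l :
  has_dim A k -> has_dim A l -> k = l.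
Proof.
move=> [W [eW <-]] [X [eX <-]]; congr (\dim _); apply/vspaceP => x.
have e : [set` W] = [set` X] by rewrite -eW.
by apply/idP/idP => h; [have: [set` X] x by rewrite -e|have: [set` W] x by rewrite e].
Qed.

Lemma rdimE (R : fieldType) (V : vectType R) (A : set V) k :
  has_dim A k -> rdim A = k.
Proof.
move=> h; rewrite /rdim; case: xgetP => [l _ hl|/(_ k)//].
exact: has_dim_uniq hl h.
Qed.

Lemma has_dim_rdim (R : fieldType) (V : vectType R) (A : set V) :
  A 0 -> (forall (a : R) x y, A x -> A y -> A (a *: x + y)) -> has_dim A (rdim A).
Proof.
move=> A0 Alin.
suff [k hk] : exists k, has_dim A k by rewrite (rdimE hk).
pose P (n : nat) := `[< exists W : {vspace V}, [set` W] `<=` A /\ \dim W = n >].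
have exP : exists n, P n.
  exists 0%N; apply/asboolP; exists 0%VS; rewrite dimv0; split=> // x /=.
  by rewrite memv0 => /eqP ->.
have ubP n : P n -> (n <= dim V)%N.
  by move=> /asboolP[W [_ <-]]; rewrite -dimvf; exact: dimvS (subvf _).
case: (ex_maxnP exP ubP) => n /asboolP[W [WA dW]] maxn.
exists n, W; split=> //; apply/seteqP; split => // x Ax /=.
have: (\dim (W + <[x]>) <= \dim W)%N.
  rewrite dW; apply: maxn; apply/asboolP; exists (W + <[x]>)%VS; split=> // y /=.
  case/memv_addP => u Wu [v /vlineP[a ->]] ->.
  by rewrite addrC; apply: Alin => //; exact: WA.
rewrite (geq_leqif (dimv_leqif_sup (addvSl W <[x]>))) => /subvP; apply.
by rewrite -{1}[x]add0r; apply: memv_add; rewrite ?mem0v ?memv_line.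
Qed.

Section UnitaryDefect.
Variables (R : realType) (N : nat).
Implicit Types (U V : 'M[R[i]]_N).

(* [mxvec] lists the entries row by row. *)
Definition vecR V : 'rV[R]_(N * N + N * N) :=
  row_mx (mxvec (\matrix_(i, j) complex.Re (V i j))) (mxvec (\matrix_(i, j) complex.Im (V i j))).

Definition tangent_unitary U : set 'M[R[i]]_N :=
  [set E *m U | E in [set E : 'M[R[i]]_N | E ^t* = - E]].

(* The real differential at [U] of the map [V |-> (|V_ij|^2)_ij]. *)
Definition Df U V : 'M[R]_N :=
  \matrix_(i, j) (2 * complex.Re (Num.conj (U i j) * V i j)).

Definition defect U : int :=
  (N%:Z - 1) ^+ 2 - (rdim (Df U @` tangent_unitary U))%:Z.

Lemma has_dim_Df_tangent_unitary U :
  has_dim (Df U @` tangent_unitary U) (rdim (Df U @` tangent_unitary U)).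
Proof.
apply: has_dim_rdim.
  exists 0; last by apply/matrixP => i j; rewrite !mxE mulr0 /= mulr0.
  by exists 0; rewrite ?mul0mx //=; apply/matrixP => i j; rewrite !mxE oppr0 rmorph0.
move=> a _ _ [_ [E hE <-] <-] [_ [E' hE' <-] <-].
exists ((a%:C *: E + E') *m U).
  exists (a%:C *: E + E') => //=; apply/matrixP => i j; rewrite !mxE.
  have := congr1 (fun M : 'M[R[i]]_N => M i j) hE; rewrite !mxE => hij.
  have := congr1 (fun M : 'M[R[i]]_N => M i j) hE'; rewrite !mxE => hij'.
  rewrite rmorphD rmorphM /= hij hij' opprD -mulrN; congr (_ * _ + _).
  by apply/eqP; rewrite eq_complex /= oppr0 !eqxx.
apply/matrixP => i j; rewrite mulmxDl -scalemxAl !mxE mulrDr raddfD mulrDr /=.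
congr (_ + _); rewrite mulrCA [RHS]mulrCA; congr (_ * _).
have H (z : R[i]) : complex.Re (a%:C * z) = a * complex.Re z.
  by case: z => x y /=; rewrite mul0r subr0.
exact: H.
Qed.

(* The candidates for the elements of a spanning set; [rows] and [cols] list
   the indices [i_1, ..., i_p] and [j_1, ..., j_r]. *)
Definition spanning_vectors U (rows cols : seq 'I_N) :=
  [seq vecR (('i%C *: diag_mx (delta_mx 0 k)) *m U) | k <- rows] ++
  [seq vecR (U *m ('i%C *: diag_mx (delta_mx 0 l))) | l <- cols].

(* [basis_of] includes linear independence of the listed vectors, hence that
   they are pairwise distinct. *)
Definition is_spanning_set U (rows cols : seq 'I_N) :=
  (size rows + size cols <= 2 * N - 1)%N /\
  basis_of <<spanning_vectors U (enum 'I_N) (enum 'I_N)>>%VS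
    (spanning_vectors U rows cols).

Definition pattern_mx (I : {set 'I_N * 'I_N}) : 'M[R]_N :=
  \sum_(ij in I) (delta_mx ij.1 0 : 'cV_N) *m (delta_mx ij.2 0 : 'cV_N)^T.

Definition hadamard (A B : 'M[R]_N) : 'M[R]_N := map2_mx *%R A B.

Definition is_pattern_set U (rows cols : seq 'I_N) (I : {set 'I_N * 'I_N}) :=
  let e (k : 'I_N) : 'cV[R]_N := delta_mx k 0 in
  let ones : 'cV[R]_N := const_mx 1 in
  let F := pattern_mx I in
  [/\ #|I| = (size rows + size cols)%N,
      forall i j, (i, j) \in I -> U i j != 0
    & free ([seq mxvec (hadamard (e k *m ones^T) F) | k <- rows] ++
            [seq mxvec (hadamard (ones *m (e l)^T) F) | l <- cols])].

Definition same_moduli U V := forall i j, `|V i j| = `|U i j|.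

Definition dephased U (I : {set 'I_N * 'I_N}) V :=
  forall i j, (i, j) \in I -> V i j = U i j.

Definition num_zeros U : nat := #|[set ij : 'I_N * 'I_N | U ij.1 ij.2 == 0]|.

Definition bound_b U (rows cols : seq 'I_N) : int :=
  defect U + (2 * N%:Z - 1) - (num_zeros U)%:Z
  - (size (spanning_vectors U rows cols))%:Z.

End UnitaryDefect.

(* [M] is a [k]-dimensional (embedded, C^1) submanifold of R^n: around each of
   its points it is homeomorphically parametrised by a C^1 immersion [phi] of an
   open subset [W] of R^k, with inverse [psi]. *)
Definition submanifold (R : realType) (n k : nat) (M : set 'rV[R]_n) :=
  forall x, M x ->
  exists (O : set 'rV[R]_n) (W : set 'rV[R]_k)
         (phi : 'rV[R]_k -> 'rV[R]_n) (psi : 'rV[R]_n -> 'rV[R]_k),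
  [/\ [/\ open O, O x & open W],
      phi @` W = M `&` O,
      forall y, W y ->
        [/\ differentiable phi y, {for y, continuous (jacobian phi)}
          & injective ('d phi y)]
    & (forall y, W y -> psi (phi y) = y) /\
      {within M `&` O, continuous psi}].

(* Velocities at [x] of differentiable curves lying in [M]. *)
Definition tangent_space (R : realType) (n : nat) (M : set 'rV[R]_n)
    (x : 'rV[R]_n) : set 'rV[R]_n :=
  [set v | exists (gamma : R -> 'rV[R]_n) (eps : R),
    [/\ 0 < eps,
        forall t, `|t| < eps -> M (gamma t) /\ derivable gamma t 1,
        gamma 0 = x
      & derive1 gamma 0 = v]].

(* Main.v *)
(** A velocity [W] of a curve of unitaries with the moduli of [U] has the form
    [W = i (r o U)] with [r] real, where [r] lies in the space [X] of those [r] for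
    which [i (r o U)] is tangent to the unitary group at [U].  If [H] is the matrix
    [(r o U) U*] and [E] is antihermitian, then the pairing of [r] with [Df_U(EU)] is
    a multiple of [Re tr(E* H)], which vanishes because [H] is hermitian for [r] in
    [X].  So [X] is orthogonal to [Df_U(T_U)].  Now [X] contains three independent
    subspaces: the [r] coming from the manifold, which vanish on the pattern set
    and at the zeros of [U]; the matrices supported on the zeros of [U]; and the
    span of the [e_k e^T] and [e e_l^T], whose restrictions to the pattern set are
    independent.  Counting dimensions in the [N x N] real matrices gives the bound.
    The tangent space is identified with the image of the differential of a
    chart. *)

From HB Require Import structures.
Require Import Defs.
From mathcomp Require Import all_boot all_order all_algebra.
From mathcomp Require Import spectral complex.
From mathcomp Require Import all_classical all_reals all_analysis.
From mathcomp Require Import ring lra.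

Set Implicit Arguments.
Unset Strict Implicit.
Unset Printing Implicit Defensive.

Import Order.TTheory GRing.Theory Num.Theory.
Import numFieldNormedType.Exports.

Local Open Scope classical_set_scope.
Local Open Scope ring_scope.
Local Open Scope complex_scope.
Local Open Scope sesquilinear_scope.

(** * Free families, spans and kernels *)

Section LinearAlgebra.
Variables (K : fieldType) (aT rT : vectType K).

(** Rank-nullity on [<<X>>]: the image already has dimension [size X], which bounds [\dim <<X>>]
    from above, so nothing is left for the kernel. *)
Lemma lker_free_map (f : 'Hom(aT, rT)) (X : seq aT) :
  free (map f X) -> free X /\ (<<X>> :&: lker f = 0)%VS.
Proof.
rewrite /free -limg_span size_map => /eqP dimfX.
have := limg_ker_dim f <<X>>%VS; rewrite dimfX => dimX.
have le0 : (\dim (<<X>> :&: lker f) + size X <= 0 + size X)%N.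
  by rewrite dimX add0n dim_span.
move: le0; rewrite leq_add2r leqn0 => dim0.
by move: dimX; rewrite (eqP dim0) => <-; split => //; apply/eqP; rewrite -dimv_eq0.
Qed.

End LinearAlgebra.


Lemma span_ind (K : fieldType) (aT : vectType K) (P : aT -> Prop) (X : seq aT) : P 0 ->
  (forall a u v, P u -> P v -> P (a *: u + v)) ->
  (forall x, x \in X -> P x) -> forall v, v \in <<X>>%VS -> P v.
Proof.
move=> P0 Plin; elim: X => [|x X IH] PX v.
  by rewrite span_nil memv0 => /eqP ->.
rewrite span_cons => /memv_addP[_ /vlineP[a ->] [w wX ->]].
apply: Plin; first by apply: PX; rewrite mem_head.
by apply: IH wX => y yX; apply: PX; rewrite in_cons yX orbT.
Qed.

(** Every combination of the remaining matrix units vanishes at the entry [p], where the unit of [p]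
    itself is [1]. *)
Lemma free_delta_mx (K : fieldType) (m n : nat) (s : seq ('I_m * 'I_n)) :
  uniq s -> free [seq delta_mx p.1 p.2 : 'M[K]_(m, n) | p <- s].
Proof.
elim: s => [|p s IH] /=; first by rewrite nil_free.
move=> /andP[ps us]; rewrite free_cons IH // andbT; apply/negP => h.
suff : (delta_mx p.1 p.2 : 'M[K]_(m, n)) p.1 p.2 = 0.
  by rewrite mxE !eqxx => /eqP; rewrite oner_eq0.
pose Q (M : 'M[K]_(m, n)) := M p.1 p.2 = 0.
apply: (span_ind (P := Q)) h => [|a u v hu hv|_ /mapP[q qs ->]]; rewrite /Q !mxE //.
  by rewrite hu hv mulr0 addr0.
have : p != q by apply: contraNneq ps => ->.
by rewrite -pair_eqE /pair_eq /= => /negPf ->.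
Qed.

(** * Phase directions at a unitary matrix and the dimension count *)

Section Phases.
Variables (R : realType) (N : nat).
Implicit Types (U : 'M[R[i]]_N) (r : 'M[R]_N).

(* [i (r o U)] is tangent to the unitary group at [U]; equivalently, [(r o U) U*]
   is hermitian. *)
Definition tangent_phase U r := forall i j,
  \sum_l (r i l - r j l)%:C * (U i l * Num.conj (U j l)) = 0.

Lemma tangent_phase_linear U (a : R) r s :
  tangent_phase U r -> tangent_phase U s -> tangent_phase U (a *: r + s).
Proof.
move=> hr hs i j; have := congr2 (fun x y => a%:C * x + y) (hr i j) (hs i j).
rewrite mulr0 addr0 mulr_sumr -big_split; apply: etrans; apply: eq_bigr => l _ /=.
by rewrite [X in _ = X + _]mulrA -rmorphM -mulrDl !mxE -rmorphD /= mulrBr opprD addrACA.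
Qed.

Lemma conj_antiself_Re0 (z : R[i]) : Num.conj z = - z -> complex.Re z = 0.
Proof.
case: z => x y /eqP; rewrite eq_complex /= => /andP[/eqP h _].
lra.
Qed.

(** Conjugating the double sum and exchanging the two indices changes its sign, so it is purely
    imaginary. *)
Lemma sumr_mul_conj_sym (n : nat) (E h : 'I_n -> 'I_n -> R[i]) :
  (forall i j, Num.conj (E i j) = - E j i) ->
  (forall i j, Num.conj (h i j) = h j i) ->
  complex.Re (\sum_i \sum_j E i j * h i j) = 0.
Proof.
move=> hE hh; apply: conj_antiself_Re0.
rewrite rmorph_sum [in RHS]exchange_big -sumrN; apply: eq_bigr => i _.
rewrite rmorph_sum -sumrN; apply: eq_bigr => j _.
by rewrite rmorphM /= hE hh mulNr.
Qed.

Lemma tangent_phase_orthogonal U r (g : 'M[R]_N) : tangent_phase U r ->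
  (Df U @` tangent_unitary U) g -> \sum_i \sum_j r i j * g i j = 0.
Proof.
move=> hr [_ [E /matrixP hE <-] <-].
(* [h] is the entrywise conjugate of [(r o U) U*]; the hypothesis [hr] says exactly that it is
   hermitian. *)
pose h i k := \sum_j (r i j)%:C * (Num.conj (U i j) * U k j).
have hh i k : Num.conj (h i k) = h k i.
  rewrite rmorph_sum; apply/eqP; rewrite -subr_eq0 -sumrB; apply/eqP.
  apply: etrans (hr i k); apply: eq_bigr => j _; rewrite !rmorphM /= conjCK.
  have -> : Num.conj (r i j)%:C = (r i j)%:C by exact: conjc_real.
  rewrite rmorphB /= ; ring.
have hE' i j : Num.conj (E i j) = - E j i by have := hE j i; rewrite !mxE.
transitivity (2 * complex.Re (\sum_i \sum_k E i k * h i k)); last first.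
  by rewrite sumr_mul_conj_sym ?mulr0.
have ReC (a : R) (z : R[i]) : a * complex.Re z = complex.Re (a%:C * z).
  by case: z => x y /=; rewrite mul0r subr0.
rewrite raddf_sum mulr_sumr; apply: eq_bigr => i _ /=.
transitivity (2 * \sum_j complex.Re ((r i j)%:C * (Num.conj (U i j) * (E *m U) i j))).
  by rewrite mulr_sumr; apply: eq_bigr => j _; rewrite /Df mxE -ReC; ring.
rewrite -(raddf_sum (@complex.Re R)); congr (2 * complex.Re _).
transitivity (\sum_j \sum_k E i k * ((r i j)%:C * (Num.conj (U i j) * U k j))).
  apply: eq_bigr => j _; rewrite mxE !mulr_sumr; apply: eq_bigr => k _; ring.
by rewrite exchange_big; apply: eq_bigr => k _; rewrite mulr_sumr.
Qed.

Lemma sum_sqr_mx_eq0 r : \sum_i \sum_j r i j * r i j = 0 -> r = 0.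
Proof.
move=> h; apply/matrixP => i j; rewrite mxE.
have ge0 k : 0 <= \sum_j r k j * r k j by apply: sumr_ge0 => l _; exact: sqr_ge0.
have /eqP := psumr_eq0P (fun k _ => ge0 k) h (i := i) isT.
rewrite psumr_eq0 => [/allP /(_ j)|l _]; last exact: sqr_ge0.
by rewrite mem_index_enum mulf_eq0 orbb => /(_ isT) /eqP.
Qed.

(** The phase difference does not depend on the column, so it factors out of the inner product of
    two rows of [U], which is zero for distinct rows. *)
Lemma tangent_phase_row U (k : 'I_N) : U \is unitarymx ->
  tangent_phase U (delta_mx k 0 *m (const_mx 1 : 'cV_N)^T).
Proof.
move=> /unitarymxP hU i j.
have E a l : (delta_mx k 0 *m (const_mx 1 : 'cV[R]_N)^T) a l = (a == k)%:R.
  by rewrite !mxE big_ord1 !mxE eqxx andbT mulr1.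
have [<-|ij] := eqVneq i j.
  by rewrite big1 // => l _; rewrite subrr mul0r.
under eq_bigr => l _ do rewrite !E.
rewrite -mulr_sumr; have /matrixP/(_ i j) := hU; rewrite !mxE (negPf ij).
by under eq_bigr do rewrite !mxE; move=> ->; rewrite mulr0.
Qed.

Lemma tangent_phase_col U (k : 'I_N) :
  tangent_phase U (const_mx 1 *m (delta_mx k 0 : 'cV_N)^T).
Proof.
move=> i j; rewrite big1 // => l _.
by rewrite [X in (X - _)%:C]mxE [X in (_ - X)%:C]mxE !big_ord1 !mxE subrr mul0r.
Qed.

Lemma tangent_phase_support U r :
  (forall i j, U i j != 0 -> r i j = 0) -> tangent_phase U r.
Proof.
move=> hr i j; rewrite big1 // => l _.
have [->|/hr ->] := eqVneq (U i l) 0; first by rewrite mul0r mulr0.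
have [->|/hr ->] := eqVneq (U j l) 0; first by rewrite conjC0 !mulr0.
by rewrite subrr mul0r.
Qed.

(** On the matrices of [phase_gens] this linear map takes the values that [is_pattern_set] requires
    to be free, so that condition becomes one about its kernel. *)
Definition pattern_mask (I : {set 'I_N * 'I_N}) r := mxvec (hadamard r (pattern_mx R I)).

Lemma pattern_mxE (I : {set 'I_N * 'I_N}) i j :
  pattern_mx R I i j = ((i, j) \in I)%:R.
Proof.
have E (p : 'I_N * 'I_N) :
    ((delta_mx p.1 0 : 'cV[R]_N) *m (delta_mx p.2 0 : 'cV_N)^T) i j = ((i, j) == p)%:R.
  by rewrite mxE big_ord1 !mxE !andbT -natrM mulnb -pair_eqE.
rewrite /pattern_mx summxE; under eq_bigr do rewrite E.
have [ijI|ijI] := boolP (_ \in _).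
  rewrite (bigD1 _ ijI) /= eqxx big1 ?addr0 // => p /andP[_ /negPf].
  by rewrite eq_sym => ->.
by rewrite big1 // => p pI; rewrite (_ : _ == _ = false) //; apply: contraNF ijI => /eqP ->.
Qed.

Lemma pattern_mask_eq0 (I : {set 'I_N * 'I_N}) r :
  pattern_mask I r = 0 <-> forall i j, (i, j) \in I -> r i j = 0.
Proof.
rewrite /pattern_mask; split=> h.
  have /matrixP h' : hadamard r (pattern_mx R I) = 0 by rewrite -[LHS]mxvecK h linear0.
  by move=> i j ijI; have := h' i j; rewrite !mxE pattern_mxE ijI mulr1.
suff -> : hadamard r (pattern_mx R I) = 0 by rewrite linear0.
apply/matrixP => i j; rewrite !mxE pattern_mxE.
by have [/h ->|_] := boolP (_ \in _); rewrite ?mul0r ?mulr0.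
Qed.

Fact pattern_mask_is_linear I : linear (pattern_mask I).
Proof.
move=> a r s; rewrite /pattern_mask -linearP; congr mxvec.
by apply/matrixP => i j; rewrite !mxE mulrDl mulrA.
Qed.

HB.instance Definition _ I := GRing.isLinear.Build R 'M[R]_N 'rV[R]_(N * N) _
  (pattern_mask I) (pattern_mask_is_linear I).

(** These are the [r] for which [i (r o U)] is [i diag(e_k) U] or [U i diag(e_l)], that is, the
    phases of the spanning vectors. *)
Definition phase_gens (rows cols : seq 'I_N) : seq 'M[R]_N :=
  [seq (delta_mx k 0 : 'cV_N) *m (const_mx 1 : 'cV_N)^T | k <- rows] ++
  [seq (const_mx 1 : 'cV_N) *m (delta_mx l 0 : 'cV_N)^T | l <- cols].

(** The second part separates the span of the generators from all phases vanishing on [I]; both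
    parts come from [lker_free_map] applied to [pattern_mask I]. *)
Lemma pattern_set_gens U rows cols I : is_pattern_set U rows cols I ->
  free (phase_gens rows cols) /\
  forall r, r \in <<phase_gens rows cols>>%VS ->
    (forall i j, (i, j) \in I -> r i j = 0) -> r = 0.
Proof.
case=> _ _ hfree.
have : free (map (linfun (pattern_mask I)) (phase_gens rows cols)).
  rewrite map_cat -!map_comp; congr (is_true (free (_ ++ _))): hfree;
  by apply: eq_map => k /=; rewrite lfunE.
move=> /lker_free_map[hf h0]; split=> // r hr /pattern_mask_eq0 hr0.
by apply/eqP; rewrite -memv0 -h0 memv_cap hr memv_ker lfunE /= hr0.
Qed.

Lemma dim_tangent_phase_le U rows cols I (Y : {vspace 'M[R]_N}) :
  U \is unitarymx -> is_pattern_set U rows cols I ->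
  (forall r, r \in Y -> [/\ tangent_phase U r,
     forall i j, U i j = 0 -> r i j = 0 & forall i j, (i, j) \in I -> r i j = 0]) ->
  (rdim (Df U @` tangent_unitary U) + (\dim Y + num_zeros U + (size rows + size cols))
    <= N * N)%N.
Proof.
move=> hU hI hY.
have [freeA A0] := pattern_set_gens hI; have [_ U0 _] := hI.
have [G [GE <-]] := has_dim_Df_tangent_unitary U.
pose zs := enum [pred ij : 'I_N * 'I_N | U ij.1 ij.2 == 0].
pose Z := <<[seq delta_mx p.1 p.2 : 'M[R]_N | p <- zs]>>%VS.
have dZ : \dim Z = num_zeros U.
  rewrite (eqP (free_delta_mx R (enum_uniq _))) size_map -cardE.
  by apply: eq_card => ij; apply/idP/idP; rewrite in_setE.
have Zsupp r : r \in Z -> forall i j, U i j != 0 -> r i j = 0.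
  move=> rZ i j Uij; pose Q (M : 'M[R]_N) := M i j = 0.
  apply: (span_ind (P := Q)) rZ => [|a u v hu hv|_ /mapP[q qs ->]]; rewrite /Q !mxE //.
    by rewrite hu hv mulr0 addr0.
  move: qs; rewrite mem_enum inE => Uq.
  have [iq|//] := eqVneq i q.1; have [jq|//] := eqVneq j q.2.
  by rewrite iq jq Uq in Uij.
set A := phase_gens rows cols.
have dA : \dim <<A>> = (size rows + size cols)%N.
  by rewrite (eqP freeA) size_cat !size_map.
have AX r : r \in <<A>>%VS -> tangent_phase U r.
  apply: span_ind => [i j|a u v|x].
  - by rewrite big1 // => l _; rewrite !mxE subrr mul0r.
  - exact: tangent_phase_linear.
  - rewrite mem_cat => /orP[] /mapP[k _ ->]; first exact: tangent_phase_row.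
    exact: tangent_phase_col.
have capYZ : (Y :&: Z = 0)%VS.
  apply/eqP; rewrite -subv0; apply/subvP => r /memv_capP[rY rZ].
  rewrite memv0; apply/eqP/matrixP => i j; rewrite mxE.
  have [/eqP Uij|] := boolP (U i j == 0); last exact: Zsupp.
  by have [_ -> //] := hY r rY.
(* On [I] the elements of [Y] vanish by hypothesis and those of [Z] because [U] is nonzero there, so
   [A0] applies. *)
have capA : ((Y + Z) :&: <<A>> = 0)%VS.
  apply/eqP; rewrite -subv0; apply/subvP => r /memv_capP[/memv_addP[y yY [z zZ ->]] hA].
  rewrite memv0; apply/eqP/A0 => // i j ijI; rewrite mxE.
  by have [_ _ ->] := hY y yY; rewrite // Zsupp ?addr0 // U0.
(* A common element is both a tangent phase and a value of the differential, hence orthogonal to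
   itself. *)
have capG : (G :&: (Y + Z + <<A>>) = 0)%VS.
  apply/eqP; rewrite -subv0; apply/subvP => r /memv_capP[rG].
  move=> /memv_addP[_ /memv_addP[y yY [z zZ ->]] [a aA rE]].
  rewrite memv0; apply/eqP/sum_sqr_mx_eq0; apply: (@tangent_phase_orthogonal U).
    rewrite rE -[y]scale1r -[_ + z]scale1r; apply: tangent_phase_linear (AX _ aA).
    apply: tangent_phase_linear; first by have [] := hY y yY.
    by apply: tangent_phase_support; exact: Zsupp.
  by rewrite GE.
have := dimvS (subvf (G + (Y + Z + <<A>>))).
by rewrite !dimv_disjoint_sum // dimvf dZ dA.
Qed.

End Phases.

(** * Derivatives of complex-valued functions of a real variable, taken componentwise *)

Section ComplexDerivative.
Variable (R : realType).
Implicit Types (f g : R -> R[i]).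

Definition is_cderive f (t : R) (d : R[i]) :=
  is_derive t 1 (fun s => complex.Re (f s)) (complex.Re d) /\
  is_derive t 1 (fun s => complex.Im (f s)) (complex.Im d).

Lemma is_cderiveM f g t df dg : is_cderive f t df -> is_cderive g t dg ->
  is_cderive (fun s => f s * g s) t (df * g t + f t * dg).
Proof.
case=> fr fi [gr gi].
set reC := fun f s => complex.Re (f s) in fr gr *.
set imC := fun f s => complex.Im (f s) in fi gi *.
split.
  have -> : (fun s => complex.Re (f s * g s)) = reC f * reC g - imC f * imC g.
    by apply/funext => s; rewrite !fctE /reC /imC; case: (f s) (g s) => ? ? [].
  apply: is_derive_eq (is_deriveB (is_deriveM fr gr) (is_deriveM fi gi)) _.
  rewrite /reC /imC /GRing.scale /=.
  by case: (f t) (g t) (df) (dg) => ? ? [? ?] [? ?] [? ?] /=; ring.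
have -> : (fun s => complex.Im (f s * g s)) = reC f * imC g + imC f * reC g.
  by apply/funext => s; rewrite !fctE /reC /imC; case: (f s) (g s) => ? ? [? ?] /=; ring.
apply: is_derive_eq (is_deriveD (is_deriveM fr gi) (is_deriveM fi gr)) _.
rewrite /reC /imC /GRing.scale /=.
by case: (f t) (g t) (df) (dg) => ? ? [? ?] [? ?] [? ?] /=; ring.
Qed.

Lemma is_cderive_conj f t df : is_cderive f t df ->
  is_cderive (fun s => Num.conj (f s)) t (Num.conj df).
Proof.
case=> fr fi; split.
  have -> : (fun s => complex.Re (Num.conj (f s))) = (fun s => complex.Re (f s)).
    by apply/funext => s; case: (f s).
  by have -> : complex.Re (Num.conj df) = complex.Re df by case: (df).
have -> : (fun s => complex.Im (Num.conj (f s))) = - (fun s => complex.Im (f s)).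
  by apply/funext => s; rewrite fctE; case: (f s).
have -> : complex.Im (Num.conj df) = - complex.Im df by case: (df).
exact: is_deriveN.
Qed.

Lemma is_cderive_sum (n : nat) (f : 'I_n -> R -> R[i]) t (d : 'I_n -> R[i]) :
  (forall i, is_cderive (f i) t (d i)) ->
  is_cderive (fun s => \sum_i f i s) t (\sum_i d i).
Proof.
move=> h; split.
  have -> : (fun s => complex.Re (\sum_i f i s)) = \sum_i (fun s => complex.Re (f i s)).
    by apply/funext => s; rewrite fct_sumE raddf_sum.
  by rewrite raddf_sum; apply: is_derive_sum => i; have [] := h i.
have -> : (fun s => complex.Im (\sum_i f i s)) = \sum_i (fun s => complex.Im (f i s)).
  by apply/funext => s; rewrite fct_sumE raddf_sum.
by rewrite raddf_sum; apply: is_derive_sum => i; have [] := h i.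
Qed.

Lemma is_cderive_near_cst f t c d :
  (\near t, f t = c) -> is_cderive f t d -> d = 0.
Proof.
move=> fc [[_ fr] [_ fi]]; apply/eqP; rewrite eq_complex -fr -fi /=.
rewrite (near_eq_derive (g := cst (complex.Re c))) ?oner_eq0 ?derive_cst //; last first.
  by apply: filterS fc => s ->.
rewrite (near_eq_derive (g := cst (complex.Im c))) ?oner_eq0 ?derive_cst ?eqxx //.
by apply: filterS fc => s ->.
Qed.

End ComplexDerivative.

(** * First-order constraints on curves of dephased unitaries with fixed moduli *)

Section ConstantModuli.
Variables (R : realType) (N : nat).
Implicit Types (U V : 'M[R[i]]_N).

Definition unvecR (v : 'rV[R]_(N * N + N * N)) : 'M[R[i]]_N :=
  \matrix_(i, j) (lsubmx v 0 (mxvec_index i j) +i* rsubmx v 0 (mxvec_index i j)).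

Lemma vecRK : cancel (@vecR R N) unvecR.
Proof.
move=> V; apply/matrixP => i j; rewrite mxE row_mxKl row_mxKr !mxvecE !mxE.
by case: (V i j).
Qed.

Lemma unvecR_is_cderive (gamma : R -> 'rV[R]_(N * N + N * N)) t i j :
  derivable gamma t 1 ->
  is_cderive (fun s => unvecR (gamma s) i j) t (unvecR (derive1 gamma t) i j).
Proof.
move=> dg; rewrite derive1E derive_mx //.
have dc l : is_derive t 1 (fun s => gamma s 0 l) ('D_1 (fun s => gamma s 0 l) t).
  by apply: derivableP; exact: (derivable_mxP _ _ _).1.
split.
  under eq_fun do rewrite !mxE /=.
  by rewrite !mxE /=.
under eq_fun do rewrite !mxE /=.
by rewrite !mxE /=.
Qed.

Variables (U : 'M[R[i]]_N) (I : {set 'I_N * 'I_N}).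
Variable F : set 'rV[R]_(N * N + N * N).
Hypothesis hF : forall v, F v -> exists V : 'M[R[i]]_N,
  [/\ v = vecR V, V \is unitarymx, same_moduli U V & dephased U I V].

(** Each clause differentiates at [0] a quantity that is constant along the curve: an entry of
    [V V*], a squared modulus, an entry that stays zero, an entry fixed by dephasing. The third is
    separate because the second reads [0 = 0] where [U] vanishes. *)
Lemma constant_moduli_tangent v : tangent_space F (vecR U) v ->
  [/\ forall i j, \sum_l (unvecR v i l * Num.conj (U j l)
                         + U i l * Num.conj (unvecR v j l)) = 0,
      forall i j, unvecR v i j * Num.conj (U i j) + U i j * Num.conj (unvecR v i j) = 0,
      forall i j, U i j = 0 -> unvecR v i j = 0
    & forall i j, (i, j) \in I -> unvecR v i j = 0].
Proof.
case=> gamma [eps [eps0 hg g0 gv]].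
pose V t := unvecR (gamma t).
have V0 : V 0 = U by rewrite /V g0 vecRK.
have dV i j : is_cderive (fun t => V t i j) 0 (unvecR v i j).
  by rewrite -gv; apply: unvecR_is_cderive; have [] := hg 0; rewrite ?normr0.
have dVc i j : is_cderive (fun t => Num.conj (V t i j)) 0 (Num.conj (unvecR v i j)).
  exact: is_cderive_conj.
pose ok t := [/\ V t \is unitarymx, same_moduli U (V t) & dephased U I (V t)].
have nV : \forall t \near (0 : R), ok t.
  apply: (filterS _ (nbhs0_lt (V := R) eps0)) => t /hg[/hF[W [gW uW mW dW]] _].
  by rewrite /ok /V gW vecRK.
have const f c d : (forall t, ok t -> f t = c) -> is_cderive f 0 d -> d = 0.
  by move=> fc; apply: is_cderive_near_cst; apply: filterS nV => t; exact: fc.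
split=> i j.
- pose f t := \sum_l V t i l * Num.conj (V t j l).
  apply: (const f (i == j)%:R) => [t [/unitarymxP/matrixP/(_ i j)]|].
    by rewrite !mxE => <- _ _; apply: eq_bigr => l _; rewrite !mxE.
  by rewrite -V0; apply: is_cderive_sum => l; exact: is_cderiveM.
- pose f t := V t i j * Num.conj (V t i j).
  apply: (const f (`|U i j| ^+ 2)) => [t [_ mV _]|].
    by rewrite /f -mV normCK.
  by rewrite -V0; exact: is_cderiveM.
- move=> Uij; apply: (const _ 0) (dV i j) => t [_ /(_ i j)].
  by rewrite Uij normr0 => /eqP; rewrite normr_eq0 => /eqP.
- by move=> ijI; apply: (const _ (U i j)) (dV i j) => t [_ _]; exact.
Qed.

End ConstantModuli.

(** * Tangent spaces of submanifolds as ranges of chart differentials *)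

Section TangentSpace.
Variable R : realType.

Lemma linear_rV_lipschitz (m n : nat) (f : {linear 'rV[R]_m -> 'rV[R]_n}) :
  exists2 c, 0 < c & forall x, `|f x| <= c * `|x|.
Proof.
(* The summand [1] keeps the constant positive when [f] is zero. *)
exists (1 + \sum_j `|f (delta_mx 0 j)|) => [|x].
  by rewrite ltr_pwDl // sumr_ge0.
rewrite [x in leLHS]row_sum_delta linear_sum mulrDl mul1r.
apply: le_trans (ler_norm_sum _ _ _) _; rewrite -[leLHS]add0r lerD // mulr_suml.
apply: ler_sum => j _; rewrite linearZ normrZ mulrC ler_wpM2l //.
by rewrite [leRHS]/Num.Def.normr /= mx_normrE (le_bigmax _ (fun ij => `|x ij.1 ij.2|) (0, j)).
Qed.

(** The curve is the image under [phi] of the line [y + t w], which stays in the open set [W] for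
    small [t]. *)
Lemma diff_tangent_space (n k : nat) (M O : set 'rV[R]_n) (W : set 'rV[R]_k)
    (phi : 'rV[R]_k -> 'rV[R]_n) (y w : 'rV[R]_k) :
  open W -> phi @` W `<=` M -> (forall z, W z -> differentiable phi z) -> W y ->
  tangent_space M (phi y) ('d phi y w).
Proof.
move=> oW WM dphi Wy.
pose line t := y + t *: w.
have dline t : differentiable line t by [].
have line0 : line 0 = y by rewrite /line scale0r addr0.
have : \forall t \near (0 : R), W (line t).
  apply: (differentiable_continuous (dline 0)); rewrite line0.
  exact: open_nbhs_nbhs.
move=> /nbhs_ballP[e /= e0 We].
exists (phi \o line), e; split=> // [t te||].
- have Wt : W (line t) by apply: We; rewrite -ball_normE /= sub0r normrN.
  split; first by apply: WM; exists (line t).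
  by apply: diff_derivable; apply: differentiable_comp => //; exact: dphi.
- by rewrite /= line0.
- have dphi0 : differentiable phi (line 0) by rewrite line0; exact: dphi.
  rewrite (derive1E' (differentiable_comp (dline 0) dphi0)).
  rewrite (diff_comp (dline 0) dphi0) /comp line0; congr ('d phi y _).
  have h : is_diff (0 : R) line (0 + ( *:%R ^~ w)) by exact: is_diffD.
  by rewrite (@diff_val _ _ _ _ _ _ _ h) !fctE add0r scale1r.
Qed.

Lemma diff_remainder_le (V W : normedModType R) (f : V -> W) (y : V) (eta : R) :
  differentiable f y -> 0 < eta ->
  \forall z \near y, `|f z - f y - 'd f y (z - y)| <= eta * `|z - y|.
Proof.
move=> df eta0; have /eqaddoP/(_ eta eta0) := diff_locally df.
rewrite (near_shift 0 y); apply: filterS => z /=.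
by rewrite !fctE /= subr0 addrK opprD addrA.
Qed.

(* The chart inverse [psi] is only continuous, but the left inverse [L] of the
   differential bounds [psi (gamma t) - y] linearly by [gamma t - phi y]; hence
   the difference quotients of [gamma] approach the range of the differential. *)
Lemma tangent_space_sub_diff (n k : nat) (M O : set 'rV[R]_n) (W : set 'rV[R]_k)
    (phi : 'rV[R]_k -> 'rV[R]_n) (psi : 'rV[R]_n -> 'rV[R]_k) (y : 'rV[R]_k)
    (L : {linear 'rV[R]_n -> 'rV[R]_k}) (v : 'rV[R]_n) :
  open O -> O (phi y) -> phi @` W = M `&` O -> W y -> differentiable phi y ->
  (forall z, W z -> psi (phi z) = z) -> {within M `&` O, continuous psi} ->
  cancel ('d phi y) L ->
  tangent_space M (phi y) v -> v = 'd phi y (L v).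
Proof.
move=> oO Oy WMO Wy dphi psiK cpsi LK [gamma [eps [eps0 hg g0 gv]]].
have [cL cL0 hL] := linear_rV_lipschitz L.
have [cA cA0 hA] := linear_rV_lipschitz ('d phi y).
(* [P] is the projection along the range of the differential onto the kernel of [L]; the goal is
   [P v = 0]. *)
pose P u := u - 'd phi y (L u).
have PB u1 u2 : P (u1 - u2) = P u1 - P u2.
  by rewrite /P (linearB L) (linearB ('d phi y)) !opprD addrACA.
have PZ a u : P (a *: u) = a *: P u by rewrite /P (linearZ_LR L) (linearZ_LR ('d phi y)) scalerBr.
have PA u : P ('d phi y u) = 0 by rewrite /P LK subrr.
pose C := 1 + cA * cL.
have C0 : 0 < C by rewrite addr_gt0 // mulr_gt0.
have hP u : `|P u| <= C * `|u|.
  rewrite /P /C mulrDl mul1r; apply: le_trans (ler_normB _ _) _; rewrite lerD //.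
  by apply: le_trans (hA _) _; rewrite -mulrA ler_pM2l.
apply/eqP; rewrite -subr_eq0 -/(P v) -normr_le0; apply/ler_addgt0Pr => e e0; rewrite add0r.
(* The three bounds on [eta] serve in turn to get [|q| <= |v| + 1], to absorb the [|w|] term in
   [hw], and to bring the final estimate [eta * K] below [e]. *)
pose K := C + 2 * C * cL * (`|v| + 1).
have K0 : 0 < K by rewrite addr_gt0 // !mulr_gt0 // ltr_wpDl.
pose eta := Num.min 1 (Num.min (2 * cL)^-1 (e / K)).
have eta0 : 0 < eta by rewrite !lt_min ltr01 invr_gt0 mulr_gt0 //= divr_gt0.
have [eta1 eta2 eta3] : [/\ eta <= 1, eta * (2 * cL) <= 1 & eta * K <= e].
  rewrite -ler_pdivlMr ?mulr_gt0 // -ler_pdivlMr // div1r.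
  by rewrite /eta !ge_min !lexx !orbT.
have dg : derivable gamma 0 1 by have [] := hg 0; rewrite ?normr0.
have cg : {for 0, continuous gamma}.
  by apply: differentiable_continuous; apply/derivable1_diffP.
have nMO : \forall t \near (0 : R), (M `&` O) (gamma t).
  have nM : \forall t \near (0 : R), M (gamma t).
    by apply: (filterS _ (nbhs0_lt (V := R) eps0)) => t /hg[].
  have nO : \forall t \near (0 : R), O (gamma t).
    by apply: cg; rewrite g0; exact: open_nbhs_nbhs.
  by apply: filterS2 nM nO => t.
(* Since [gamma] stays in [M] and [O] near [0], continuity of [psi] relative to that set allows the
   expansion of [phi] at [y] to be evaluated at [psi (gamma t)]. *)
have npsi : \forall t \near (0 : R),
    `|phi (psi (gamma t)) - phi y - 'd phi y (psi (gamma t) - y)| <= eta * `|psi (gamma t) - y|.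
  have MOy : (M `&` O) (phi y) by rewrite -WMO; exists y.
  have h : psi @ within (M `&` O) (nbhs (phi y)) --> y.
    by rewrite -[X in _ --> X](psiK y) //; exact: (subspace_continuousP _ _).1.
  have hz : nbhs (phi y) (fun z => (M `&` O) z ->
      `|phi (psi z) - phi y - 'd phi y (psi z - y)| <= eta * `|psi z - y|).
    exact: (h _ (diff_remainder_le dphi eta0)).
  rewrite -{1}g0 in hz; have {}hz : \forall t \near (0 : R), (M `&` O) (gamma t) ->
      `|phi (psi (gamma t)) - phi y - 'd phi y (psi (gamma t) - y)|
        <= eta * `|psi (gamma t) - y| := cg _ hz.
  by apply: filterS2 hz nMO => t; exact.
have nv : \forall t \near 0^', `|v - t^-1 *: (gamma t - phi y)| <= eta.
  move: dg; rewrite /derivable => /cvgrPdist_le /(_ eta eta0).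
  rewrite -/(derive gamma 0 1) -derive1E gv; apply: filterS => t /=.
  by rewrite addr0 [_%:A]mulr1 g0.
have nd (Q : set R) : (\forall t \near (0 : R), Q t) -> \forall t \near 0^', Q t.
  by move=> h; apply: (@cvg_within _ (nbhs (0 : R)) _) h.
have nall : \forall t \near (0 : R)^',
    ((M `&` O) (gamma t) /\
     `|phi (psi (gamma t)) - phi y - 'd phi y (psi (gamma t) - y)|
       <= eta * `|psi (gamma t) - y|) /\
    `|v - t^-1 *: (gamma t - phi y)| <= eta.
  by apply: filterI nv; exact: filterI (nd _ nMO) (nd _ npsi).
(* For the given [e], a single [t] satisfying all these estimates suffices. *)
have [t [[MOt npsit] nvt]] := @filter_ex _ _ (Proper_dnbhs_numFieldType (0 : R)) _ nall.
have [z Wz gz] : (phi @` W) (gamma t) by rewrite WMO.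
set w := psi (gamma t) - y; set g := gamma t - phi y; set q := t^-1 *: g.
have hE : `|g - 'd phi y w| <= eta * `|w|.
  suff -> : g - 'd phi y w = phi (psi (gamma t)) - phi y - 'd phi y (psi (gamma t) - y).
    exact: npsit.
  by rewrite /w /g -gz !psiK.
have hq : `|v - q| <= eta by exact: nvt.
(* Applying [L] to the expansion bounds [|w|] by [cL * |g|] plus at most half of [|w|]. *)
have hw : `|w| <= 2 * cL * `|g|.
  have : `|w| <= cL * `|g| + cL * (eta * `|w|).
    have wE : w = L g - L (g - 'd phi y w) by rewrite (linearB L g) LK opprB addrC subrK.
    rewrite [in leLHS]wE; apply: le_trans (ler_normB _ _) _; rewrite lerD //.
    by apply: le_trans (hL _) _; rewrite ler_pM2l.
  have := ler_wpM2r (normr_ge0 w) eta2; lra.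
(* [P] kills ['d phi y w], so only the remainder contributes. *)
have hPg : `|P g| <= C * (eta * (2 * cL * `|g|)).
  have -> : P g = P (g - 'd phi y w) by rewrite (PB g) PA subr0.
  apply: le_trans (hP _) _; rewrite ler_pM2l //.
  by apply: le_trans hE _; rewrite ler_pM2l.
have hPq : `|P q| <= C * (eta * (2 * cL * `|q|)).
  rewrite /q PZ !normrZ; have := ler_wpM2l (normr_ge0 t^-1) hPg; lra.
have hqv : `|q| <= `|v| + 1.
  have -> : q = v - (v - q) by rewrite opprB addrC subrK.
  by apply: le_trans (ler_normB _ _) _; rewrite lerD2l (le_trans hq).
have -> : P v = P (v - q) + P q by rewrite PB subrK.
apply: le_trans (ler_normD _ _) _; apply: le_trans eta3.
apply: le_trans (lerD (le_trans (hP _) (ler_wpM2l (ltW C0) hq)) hPq) _.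
have k0 : 0 <= C * (eta * (2 * cL)) by rewrite !mulr_ge0 // ltW.
by have := ler_wpM2l k0 hqv; rewrite /K; lra.
Qed.

Lemma submanifold_tangent_has_dim (n k : nat) (M : set 'rV[R]_n) (x : 'rV[R]_n) :
  submanifold k M -> M x -> has_dim (tangent_space M x) k.
Proof.
move=> hM Mx; have [B [W [phi [psi [[oB Bx oW] WMB dphi [psiK cpsi]]]]]] := hM x Mx.
have [y Wy yx] : (phi @` W) x by rewrite WMB.
have [dy _ inj] := dphi y Wy; rewrite -{x}yx in Mx Bx *.
pose A := linfun ('d phi y : 'rV[R]_k -> 'rV[R]_n).
have kerA : lker A == 0%VS by apply/lker0P => u u'; rewrite !lfunE; exact: inj.
have AE u : A u = 'd phi y u by rewrite lfunE.
exists (limg A); split; last first.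
  by rewrite limg_dim_eq ?(eqP kerA) ?capv0 // dimvf /dim /= mul1n.
apply/seteqP; split=> v /=.
  (* The injective differential has a linear left inverse, which plays the part of [L]. *)
  move=> hv; have LK : cancel ('d phi y) (A^-1)%VF by move=> u; rewrite -AE lker0_lfunK.
  have -> := tangent_space_sub_diff (L := (A^-1)%VF) oB Bx WMB Wy dy psiK cpsi LK hv.
  by rewrite -AE memv_img ?memvf.
have WM : phi @` W `<=` M by rewrite WMB => z [].
have dW z : W z -> differentiable phi z by move=> /dphi[].
by move=> /memv_imgP[u _ ->]; rewrite AE; exact: diff_tangent_space oW WM dW Wy.
Qed.


End TangentSpace.

(** * Passage from tangent vectors to real phase matrices *)

Section TangentPhases.
Variables (R : realType) (N : nat) (U : 'M[R[i]]_N).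

(* On tangent vectors [W = i (r o U)], and this recovers [r]; it is [0] at the
   zero entries of [U], where [W] vanishes as well. *)
Definition phases (v : 'rV[R]_(N * N + N * N)) : 'M[R]_N :=
  \matrix_(i, j) complex.Im (unvecR v i j / U i j).

Fact phases_is_linear : linear phases.
Proof.
move=> a u v; apply/matrixP => i j; rewrite !mxE.
have ImC (b : R) (z : R[i]) : b * complex.Im z = complex.Im (b%:C * z).
  by case: z => x y /=; rewrite mul0r addr0.
rewrite ImC -raddfD mulrA -mulrDl; congr (complex.Im (_ / _)).
by apply/eqP; rewrite eq_complex /= !mul0r subr0 addr0 !eqxx.
Qed.

HB.instance Definition _ := GRing.isLinear.Build R 'rV[R]_(N * N + N * N) 'M[R]_N _
  phases phases_is_linear.

Variables (I : {set 'I_N * 'I_N}) (F : set 'rV[R]_(N * N + N * N)).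
Hypothesis hF : forall v, F v -> exists V : 'M[R[i]]_N,
  [/\ v = vecR V, V \is unitarymx, same_moduli U V & dephased U I V].

(** Where [U] is nonzero, constancy of the moduli makes the quotient of the velocity by [U] purely
    imaginary; at the zeros of [U] both sides vanish. *)
Lemma unvecR_phases v : tangent_space F (vecR U) v ->
  forall i j, unvecR v i j = 'i%C * (phases v i j)%:C * U i j.
Proof.
move=> /(constant_moduli_tangent hF)[_ hm h0 _] i j.
have [Uij|Uij] := eqVneq (U i j) 0; first by rewrite Uij mulr0 h0.
have -> : phases v i j = complex.Im (unvecR v i j / U i j) by rewrite [LHS]mxE.
set W := unvecR v in hm *.
have z0 : W i j / U i j + Num.conj (W i j / U i j) = 0.
  rewrite rmorphM fmorphV /=; have := hm i j.
  have Uc : Num.conj (U i j) != 0 by rewrite conjC_eq0.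
  move=> h; apply: (mulIf (mulf_neq0 Uij Uc)); rewrite mul0r -h; field.
  by rewrite Uij Uc.
rewrite -[LHS](divfK Uij); congr (_ * _).
move: z0; case: (W i j / U i j) => x y /eqP; rewrite eq_complex /= => /andP[/eqP xx _].
by apply/eqP; rewrite eq_complex /=; apply/andP; split; apply/eqP; lra.
Qed.

(** With the velocity written as [i (r o U)], the derivative of the unitarity relation is [i] times
    the equation of [tangent_phase]. *)
Lemma phases_tangent v : tangent_space F (vecR U) v ->
  [/\ tangent_phase U (phases v),
      forall i j, U i j = 0 -> phases v i j = 0
    & forall i j, (i, j) \in I -> phases v i j = 0].
Proof.
move=> hv; have [hu _ h0 hI] := constant_moduli_tangent hF hv.
split=> [i j|i j Uij|i j ijI]; last first.
- by rewrite mxE hI // mul0r.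
- by rewrite mxE h0 // mul0r.
have i0 : 'i%C != 0 :> R[i] by rewrite eq_complex /= oner_eq0 andbF.
apply: (mulfI i0); rewrite mulr0 mulr_sumr; apply: etrans (hu i j).
apply: eq_bigr => l _; rewrite !(unvecR_phases hv) !rmorphM /=.
have -> : Num.conj (phases v j l)%:C = (phases v j l)%:C by exact: conjc_real.
have -> : Num.conj 'i%C = - 'i%C :> R[i] by apply/eqP; rewrite eq_complex /= oppr0 !eqxx.
rewrite rmorphB /=; ring.
Qed.

Lemma phases_inj v : tangent_space F (vecR U) v -> phases v = 0 -> v = 0.
Proof.
move=> hv h; have W0 i j : unvecR v i j = 0.
  by rewrite (unvecR_phases hv) h mxE mulr0 mul0r.
rewrite -[v]hsubmxK -[lsubmx v]vec_mxK -[rsubmx v]vec_mxK.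
suff [-> ->] : vec_mx (lsubmx v) = 0 :> 'M[R]_N /\ vec_mx (rsubmx v) = 0 :> 'M[R]_N.
  by rewrite !linear0 row_mx0.
by split; apply/matrixP => i j; have := W0 i j; rewrite !mxE => -[].
Qed.

End TangentPhases.

Theorem theorem4p7 (R : realType) (N : nat) (hN : (0 < N)%N)
    (U : 'M[R[i]]_N) (hU : U \is unitarymx)
    (rows cols : seq 'I_N) (hS : is_spanning_set U rows cols)
    (I : {set 'I_N * 'I_N}) (hI : is_pattern_set U rows cols I)
    (k : nat) (F : set 'rV[R]_(N * N + N * N)) (hF : submanifold k F)
    (hUF : F (vecR U))
    (hFV : forall v, F v -> exists V : 'M[R[i]]_N,
       [/\ v = vecR V, V \is unitarymx, same_moduli U V & dephased U I V]) :
  has_dim (tangent_space F (vecR U)) k /\ k%:Z <= bound_b U rows cols.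
Proof.
have hT := submanifold_tangent_has_dim hF hUF; split=> //.
have [T [TE dT]] := hT.
have Tv v : v \in T -> tangent_space F (vecR U) v by move=> vT; rewrite TE.
(* [phases] is injective on [T], so its image keeps the dimension [k] and can enter the count among
   real matrices. *)
pose Y := (linfun (phases U) @: T)%VS.
have dY : \dim Y = k.
  rewrite limg_dim_eq //; apply/eqP; rewrite -subv0; apply/subvP => v.
  move=> /memv_capP[/Tv hv]; rewrite memv_ker lfunE memv0 => /eqP /(phases_inj hFV hv) ->.
  by rewrite eqxx.
have hY (r : 'M[R]_N) : r \in Y -> [/\ tangent_phase U r,
    forall i j, U i j = 0 -> r i j = 0 & forall i j, (i, j) \in I -> r i j = 0].
  move=> /memv_imgP[v /Tv hv ->].
  by rewrite lfunE; have [] := phases_tangent hFV hv; split.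
have := dim_tangent_phase_le hU hI hY.
rewrite dY /bound_b /defect size_cat !size_map.
(* As [(N - 1)^2 + (2N - 1) = N^2], the bound is the dimension count rearranged. *)
have -> : (N%:Z - 1) ^+ 2 = N%:Z * N%:Z - 2 * N%:Z + 1 by ring.
rewrite -lez_nat PoszM !PoszD.
lra.
Qed.
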